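(* For every positive integer $t$ and every pair of error measures $(\eta_0,\eta_1)$, $\mathrm{SP}_t$ is exactly as hard as $\mathrm{BDIS}_t$ with respect to $(\eta_0,\eta_1)$.
   Context: Online problems with binary predictions: an instance is $I=(x,\hat x,r)$, $r=(r_1,\dots,r_n)$ requests, $x,\hat x\in\{0,1\}^n$; requests are revealed one at a time, with $r_i$ the deterministic online algorithm receives prediction $\hat x_i$ and must irrevocably output $y_i\in\{0,1\}$ before the next request; the unrevealed $x$ encodes an optimal solution. $\mathrm{Alg}(I),\mathrm{Opt}(I)$ denote profits. An error-measure pair $(\eta_0,\eta_1)$ assigns to each instance values $0\le\eta_b(I)<\infty$, $\eta_b$ being a function of the incorrectly predicted requests with prediction $b$. For $\alpha,\beta,\gamma\ge0$, an algorithm for a maximization problem is $(\alpha,\beta,\gamma)$-competitive w.r.t. $(\eta_0,\eta_1)$ if there is a constant $b$ with $\mathrm{Opt}(I)\le\alpha\mathrm{Alg}(I)+\beta\eta_0(I)+\gamma\eta_1(I)+b$ for all instances $I$. It is Pareto-optimal if for no $\varepsilon>0$ is there an $(\alpha-\varepsilon,\beta,\gamma)$-, $(\alpha,\beta-\varepsilon,\gamma)$- or $(\alpha,\beta,\gamma-\varepsilon)$-competitive algorithm. $Q$ is as hard as $P$ w.r.t. $(\eta_0,\eta_1)$ if for all $\alpha,\beta,\gamma$, an $(\alpha,\beta,\gamma)$-competitive Pareto-optimal algorithm for $Q$ implies an $(\alpha,\beta,\gamma)$-competitive algorithm for $P$ (same error measures for both); exactly as hard = both directions. $\mathrm{BDIS}_t$: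 vertex-arrival (request $r_i$ is a new vertex $v_i$ with all edges of the input graph $G$ to $v_1,\dots,v_{i-1}$), $G$ has maximum degree at most $t$; $y_i=0$ accepts $v_i$; $\{v_i:x_i=0\}$ is a maximum independent set; profit $\sum_i(1-y_i)$ if the accepted vertices are independent, else $-\infty$. $\mathrm{SP}_t$: each request is a finite set $S_i$; every requested set intersects at most $t$ other requested sets; $y_i=0$ accepts $S_i$; $\{S_i:x_i=0\}$ is a maximum collection of pairwise disjoint requested sets; profit $\sum_i(1-y_i)$ if accepted sets are pairwise disjoint, else $-\infty$. *)

(* Defs.v *)
From mathcomp Require Import all_boot all_order all_algebra finmap.
From mathcomp Require Import reals constructive_ereal.

Set Implicit Arguments.
Unset Strict Implicit.
Unset Printing Implicit Defensive.

Import Order.TTheory GRing.Theory Num.Theory.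

Local Open Scope ring_scope.

(** * Online maximization problems with binary predictions *)

Record online_problem (R : realType) := OnlineProblem {
  request : Type;
  admissible : forall n, n.-tuple request -> bool;
  encodes_opt : forall n, n.-tuple request -> n.-tuple bool -> bool;
  profit : forall n, n.-tuple request -> n.-tuple bool -> \bar R }.

Record instance (R : realType) (P : online_problem R) := Instance {
  len : nat;
  optsol : len.-tuple bool;
  prediction : len.-tuple bool;
  requests : len.-tuple (request P);
  requestsP : admissible requests;
  optsolP : encodes_opt requests optsol }.

(** The argument of the algorithm is the nonempty history of pairs
    (request, prediction) up to and including the current round; earlier
    answers are determined by the history, since the algorithm is
    deterministic. *)
Definition algorithm (R : realType) (P : online_problem R) : Type :=
  seq (request P * bool) -> bool.

Definition answers (R : realType) (P : online_problem R) (A : algorithm P)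
    (I : instance P) : (len I).-tuple bool :=
  [tuple A (take i.+1 (zip (requests I) (prediction I))) | i < len I].

Definition Alg (R : realType) (P : online_problem R) (A : algorithm P)
    (I : instance P) : \bar R :=
  profit (requests I) (answers A I).

Definition Opt (R : realType) (P : online_problem R) (I : instance P) : \bar R :=
  profit (requests I) (optsol I).

(** * Error measures *)

Definition mispredicted (R : realType) (P : online_problem R) (b : bool)
    (I : instance P) : {fset nat} :=
  [fset nat_of_ord i | i : 'I_(len I) &
     (tnth (prediction I) i == b) && (tnth (optsol I) i != b)]%fset.

(** The same error measure is evaluated on instances of problems with
    different request types, so the incorrectly predicted requests are
    identified by their positions (counted from 0) in the request sequence. *)
Record error_measure (R : realType) := ErrorMeasure {
  error_of :> {fset nat} -> R;
  error_ge0 : forall F, 0 <= error_of F }.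

Definition eta (R : realType) (P : online_problem R) (e : error_measure R)
    (b : bool) (I : instance P) : R :=
  e (mispredicted b I).

(** * Competitiveness and relative hardness *)

(** In [\bar R], [0 * -oo = 0].  Hence for [alpha = 0] an infeasible run is not
    penalized; this does not affect which triples are achievable, as the
    inequality then no longer depends on the algorithm and rejecting every
    request is feasible in the problems below. *)
Definition competitive (R : realType) (e0 e1 : error_measure R)
    (P : online_problem R) (A : algorithm P) (alpha beta gamma : R) : Prop :=
  [/\ 0 <= alpha, 0 <= beta, 0 <= gamma &
   exists b : R, forall I : instance P,
     (Opt I <= alpha%:E * Alg A I + (beta * eta e0 false I)%:E
               + (gamma * eta e1 true I)%:E + b%:E)%E].

Definition achievable (R : realType) (e0 e1 : error_measure R)
    (P : online_problem R) (alpha beta gamma : R) : Prop :=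
  exists A : algorithm P, competitive e0 e1 A alpha beta gamma.

Definition pareto_optimal (R : realType) (e0 e1 : error_measure R)
    (P : online_problem R) (A : algorithm P) (alpha beta gamma : R) : Prop :=
  competitive e0 e1 A alpha beta gamma /\
  forall eps : R, 0 < eps ->
    [/\ ~ achievable e0 e1 P (alpha - eps) beta gamma,
        ~ achievable e0 e1 P alpha (beta - eps) gamma &
        ~ achievable e0 e1 P alpha beta (gamma - eps)].

Definition as_hard_as (R : realType) (e0 e1 : error_measure R)
    (Q P : online_problem R) : Prop :=
  forall alpha beta gamma : R,
    (exists A : algorithm Q, pareto_optimal e0 e1 A alpha beta gamma) ->
    exists B : algorithm P, competitive e0 e1 B alpha beta gamma.

Definition exactly_as_hard_as (R : realType) (e0 e1 : error_measure R)
    (Q P : online_problem R) : Prop :=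
  as_hard_as e0 e1 Q P /\ as_hard_as e0 e1 P Q.

(** * The two problems *)

Definition accepted (n : nat) (y : n.-tuple bool) : {set 'I_n} :=
  [set i | tnth y i == false].

Definition maximum_set (T : finType) (p : pred {set T}) (A : {set T}) : bool :=
  p A && [forall B : {set T}, p B ==> (#|B| <= #|A|)%N].

Definition accept_profit (R : realType) (n : nat) (feasible : pred {set 'I_n})
    (y : n.-tuple bool) : \bar R :=
  if feasible (accepted y) then (\sum_(i < n) (1 - (tnth y i)%:R))%:E else -oo%E.

(** A vertex-arrival request is the set of positions of the earlier
    neighbours of the new vertex; vertices are the positions in ['I_n]. *)
Definition adjacent (n : nat) (r : n.-tuple {fset nat}) (i j : 'I_n) : bool :=
  ((i : nat) \in tnth r j) || ((j : nat) \in tnth r i).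

Definition bounded_degree_graph (t n : nat) (r : n.-tuple {fset nat}) : bool :=
  [forall i : 'I_n, all (fun j => (j < i)%N) (tnth r i)] &&
  [forall i : 'I_n, (#|[set j | adjacent r i j]| <= t)%N].

Definition independent (n : nat) (r : n.-tuple {fset nat}) (A : {set 'I_n}) :
    bool :=
  [forall i in A, forall j in A, ~~ adjacent r i j].

Definition BDIS (R : realType) (t : nat) : online_problem R :=
  {| request := {fset nat};
     admissible := @bounded_degree_graph t;
     encodes_opt := fun n r x => maximum_set (independent r) (accepted x);
     profit := fun n r y => accept_profit R (independent r) y |}.

(** Requested sets are finite sets of elements named by natural numbers.  They
    are counted by position: a repeated request of a nonempty set is another
    requested set, intersecting the first one. *)
Definition bounded_intersection (t n : nat) (r : n.-tuple {fset nat}) : bool :=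
  [forall i : 'I_n,
     (#|[set j | (j != i) && ~~ [disjoint tnth r i & tnth r j]%fset]| <= t)%N].

Definition pairwise_disjoint (n : nat) (r : n.-tuple {fset nat})
    (A : {set 'I_n}) : bool :=
  [forall i in A, forall j in A,
     (i != j) ==> [disjoint tnth r i & tnth r j]%fset].

Definition SP (R : realType) (t : nat) : online_problem R :=
  {| request := {fset nat};
     admissible := @bounded_intersection t;
     encodes_opt := fun n r x => maximum_set (pairwise_disjoint r) (accepted x);
     profit := fun n r y => accept_profit R (pairwise_disjoint r) y |}.

(* Main.v *)
(** Both reductions translate the requests online, one by one, so that the
    conflicts between requests (adjacency, respectively intersection) are the
    same before and after; optimal solutions, predictions and answers are kept
    unchanged.  A set becomes a vertex adjacent to the earlier sets that it
    meets.  A vertex [i] becomes a set of [t] new elements [(i, 0)], ...,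
    [(i, t - 1)], together with one element [(j, k)] for each earlier neighbour
    [j] of [i], where [k] is the number of neighbours of [j] that arrived
    between [j] and [i].  Since [j] has degree at most [t], it never runs out of
    elements, and since no [(j, k)] is used twice, neighbours of [j] do not meet
    because of [j]. *)

Require Import Defs.
From mathcomp Require Import all_boot all_order all_algebra finmap.
From mathcomp Require Import reals constructive_ereal.

Set Implicit Arguments.
Unset Strict Implicit.
Unset Printing Implicit Defensive.

Definition online_map (X Y : Type) (phi : seq X -> nat -> Y) : Prop :=
  forall s i k, (i < k)%N -> phi (take k s) i = phi s i.

Definition translate (X Y : Type) (phi : seq X -> nat -> Y) (s : seq X) : seq Y :=
  mkseq (phi s) (size s).

Definition translate_tuple (X Y : Type) (phi : seq X -> nat -> Y) (n : nat)
  (r : n.-tuple X) : n.-tuple Y := [tuple phi r i | i < n].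

Lemma val_translate_tuple (X Y : Type) (phi : seq X -> nat -> Y) (n : nat)
  (r : n.-tuple X) : translate_tuple phi r = translate phi r :> seq Y.
Proof.
rewrite /translate /mkseq size_tuple /= -val_enum_ord -map_comp.
exact: eq_map.
Qed.

(** Prefixes commute with an online translation, so an algorithm that sees only a history can
    translate it by itself. *)
Lemma take_translate (X Y : Type) (phi : seq X -> nat -> Y) (k : nat) (s : seq X) :
  online_map phi -> translate phi (take k s) = take k (translate phi s).
Proof.
move=> phi_online; rewrite /translate /mkseq -map_take take_iota size_take_min.
by apply/eq_in_map => i; rewrite mem_iota /= add0n ltn_min => /andP[/phi_online].
Qed.

Lemma take_zip (X Y : Type) (k : nat) (s : seq X) (u : seq Y) :
  take k (zip s u) = zip (take k s) (take k u).
Proof. by elim: k s u => [|k IH] [|x s] [|y u] //=; rewrite ?IH //; case: take. Qed.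

(** The algorithm for [P] feeds the translated history to [A]. The translated instance then has the
    same answers, profits and errors, so the bound for [A] carries over with the same constant
    [b]. *)
Lemma online_reduction (R : realType) (e0 e1 : error_measure R)
    (P Q : online_problem R) (phi : seq (request P) -> nat -> request Q) :
  online_map phi ->
  (forall n (r : n.-tuple (request P)), admissible r ->
     [/\ admissible (translate_tuple phi r),
         forall x, encodes_opt r x -> encodes_opt (translate_tuple phi r) x &
         forall y, profit (translate_tuple phi r) y = profit r y]) ->
  as_hard_as e0 e1 Q P.
Proof.
move=> phi_online phiP alpha beta gamma [A [[a0 b0 c0 [b Ab]] _]].
exists (fun h => A (zip (translate phi (unzip1 h)) (unzip2 h))).
split=> //; exists b => -[n x p r rP xP].
have [tr_adm tr_opt tr_profit] := phiP n r rP.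
have := Ab (@Instance R Q n x p (translate_tuple phi r) tr_adm (tr_opt x xP)).
rewrite /Opt /Alg /= !tr_profit.
(* The error terms agree by conversion: [mispredicted] reads only [x] and [p]. *)
congr (is_true (_ <= _%:E * profit r _ + _ + _ + _)%E).
apply: eq_from_tnth => i; rewrite !tnth_mktuple /=; congr (A _).
rewrite !take_zip unzip1_zip ?unzip2_zip ?size_takel ?size_tuple //.
by rewrite take_translate // -val_translate_tuple.
Qed.

(** The diagonal is excluded because a nonempty set meets itself, whereas an admissible graph has no
    loops. *)
Definition meet (n : nat) (r : n.-tuple {fset nat}) (i j : 'I_n) : bool :=
  (i != j) && ~~ [disjoint tnth r i & tnth r j]%fset.

Lemma meetC (n : nat) (r : n.-tuple {fset nat}) : symmetric (meet r).
Proof. by move=> i j; rewrite /meet eq_sym fdisjoint_sym. Qed.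

Lemma adjacentC (n : nat) (r : n.-tuple {fset nat}) : symmetric (adjacent r).
Proof. by move=> i j; rewrite /adjacent orbC. Qed.

Lemma adjacent_lt (n : nat) (r : n.-tuple {fset nat}) (i j : 'I_n) :
  (forall i : 'I_n, all (fun j => (j < i)%N) (tnth r i)) -> (i <= j)%N ->
  adjacent r i j = (val i \in tnth r j).
Proof.
move=> /(_ i)/allP r_lt le_ij; rewrite /adjacent.
by have [/r_lt | _] := boolP (val j \in tnth r i); rewrite ?orbF // ltnNge le_ij.
Qed.

Lemma eq_independent_pairwise_disjoint (n : nat) (g s : n.-tuple {fset nat}) :
  adjacent g =2 meet s -> independent g =1 pairwise_disjoint s.
Proof.
move=> gs A; apply: eq_forallb => i; congr (_ ==> _).
apply: eq_forallb => j; congr (_ ==> _).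
by rewrite gs /meet; case: (i != j) => //=; rewrite negbK.
Qed.

Lemma eq_card_neighbours (n : nat) (g s : n.-tuple {fset nat}) (i : 'I_n) :
  adjacent g =2 meet s ->
  #|[set j | adjacent g i j]| =
  #|[set j | (j != i) && ~~ [disjoint tnth s i & tnth s j]%fset]|.
Proof. by move=> gs; apply: eq_card => j; rewrite !inE gs /meet eq_sym. Qed.

Lemma eq_maximum_set (T : finType) (p q : pred {set T}) (A : {set T}) :
  p =1 q -> maximum_set p A = maximum_set q A.
Proof.
move=> pq; rewrite /maximum_set pq; congr (_ && _).
by apply: eq_forallb => B; rewrite pq.
Qed.

Definition earlier_meeting (s : seq {fset nat}) (i : nat) : {fset nat} :=
  [fset j in iota 0 i | ~~ [disjoint nth fset0 s j & nth fset0 s i]%fset]%fset.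

Lemma earlier_meeting_online : online_map earlier_meeting.
Proof.
move=> s i k lt_ik; apply/fsetP => j; rewrite !inE !mem_iota /= add0n.
have [lt_ji|//] := ltnP j i.
by rewrite !nth_take // (ltn_trans lt_ji).
Qed.

Lemma mem_earlier_meeting (n : nat) (r : n.-tuple {fset nat}) (i j : 'I_n) :
  (val j \in tnth (translate_tuple earlier_meeting r) i) =
  (j < i)%N && meet r j i.
Proof.
rewrite tnth_mktuple !inE mem_iota /= add0n -!tnth_nth /meet.
by case: ltngtP => // lt_ji; rewrite -val_eqE /= ltn_eqF.
Qed.

Lemma translate_earlier_meeting_lt (n : nat) (r : n.-tuple {fset nat}) (i : 'I_n) :
  all (fun j => (j < i)%N) (tnth (translate_tuple earlier_meeting r) i).
Proof.
by apply/allP => j; rewrite tnth_mktuple !inE mem_iota /= add0n => /andP[].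
Qed.

Lemma adjacent_earlier_meeting (n : nat) (r : n.-tuple {fset nat}) :
  adjacent (translate_tuple earlier_meeting r) =2 meet r.
Proof.
move=> i j; wlog le_ij : i j / (i <= j)%N => [wlog_ij|].
  case/orP: (leq_total i j) => /wlog_ij // eq_ji.
  by rewrite adjacentC eq_ji meetC.
rewrite adjacent_lt ?mem_earlier_meeting //; last exact: translate_earlier_meeting_lt.
by move: le_ij; rewrite leq_eqVlt => /predU1P[/val_inj->|->//]; rewrite /meet eqxx andbF.
Qed.

(** [pickle] codes pairs as naturals. In an admissible graph no vertex up to [j] lists [j], so the
    count over [take i s] only sees neighbours that arrived after [j]. *)
Definition incident_set (t : nat) (s : seq {fset nat}) (i : nat) : {fset nat} :=
  ([fset choice.pickle (i, k) | k in iota 0 t] `|`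
   [fset choice.pickle (j, count (fun T : {fset nat} => j \in T) (take i s)) |
      j in nth fset0 s i])%fset.

Lemma incident_set_online (t : nat) : online_map (incident_set t).
Proof.
move=> s i k lt_ik; rewrite /incident_set nth_take //.
by rewrite take_takel // ltnW.
Qed.

(** Position [i] itself is counted only in the longer prefix. The strictness keeps indices below [t]
    and separates two neighbours of the same vertex. *)
Lemma count_take_lt (T : Type) (x0 : T) (a : pred T) (s : seq T) (i j : nat) :
  (i < j)%N -> (i < size s)%N -> a (nth x0 s i) ->
  (count a (take i s) < count a (take j s))%N.
Proof.
move=> lt_ij lt_is a_i.
have -> : count a (take j s) =
    (count a (take i.+1 s) + count a (drop i.+1 (take j s)))%N.
  by rewrite -count_cat -[take i.+1 s](take_takel s lt_ij) cat_take_drop.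
by rewrite (take_nth x0) // -cats1 count_cat /= a_i addn0 addn1 leq_addr.
Qed.

Lemma count_tuple_card (T : Type) (a : pred T) (n : nat) (r : n.-tuple T) :
  count a r = #|[set j | a (tnth r j)]|.
Proof. by rewrite -sum1_count big_tuple sum1dep_card. Qed.

Lemma meet_incident_set (t n : nat) (r : n.-tuple {fset nat}) :
  bounded_degree_graph t r ->
  adjacent r =2 meet (translate_tuple (incident_set t) r).
Proof.
move=> /andP[/forallP r_lt /forallP r_deg] i j.
wlog: i j / (i <= j)%N => [wlog_ij|].
  case/orP: (leq_total i j) => /wlog_ij // eq_ji.
  by rewrite adjacentC eq_ji meetC.
rewrite leq_eqVlt => /predU1P[/val_inj<-|lt_ij].
  rewrite adjacent_lt // /meet eqxx /=; apply/negP => /(allP (r_lt i)).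
  by rewrite ltnn.
have -> : meet (translate_tuple (incident_set t) r) i j =
    ~~ [disjoint tnth (translate_tuple (incident_set t) r) i
              & tnth (translate_tuple (incident_set t) r) j]%fset.
  by rewrite /meet -val_eqE /= ltn_eqF.
rewrite adjacent_lt ?(ltnW lt_ij) // !tnth_mktuple -fsetI_eq0.
apply/idP/fset0Pn => [ij|[e]].
  exists (choice.pickle
            (val i, count (fun T : {fset nat} => val i \in T) (take j r))).
  rewrite !inE; apply/andP; split; apply/orP; [left|right]; apply/imfsetP => /=;
    last by exists (val i); rewrite //= -tnth_nth.
  eexists; last reflexivity.
  (* The index is below [t]: the prefix before [j] misses the neighbour [j], and all neighbours
     counted in [r] number at most the degree of [i]. *)
  rewrite mem_iota add0n /=; apply: leq_trans (r_deg i).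
  apply: (@leq_trans (count (fun T : {fset nat} => val i \in T) r)).
    rewrite -{2}[val r]take_size size_tuple.
    by apply: (count_take_lt (x0 := fset0)); rewrite ?size_tuple // -tnth_nth.
  rewrite count_tuple_card; apply/subset_leq_card/subsetP => k.
  by rewrite !inE /adjacent => ->.
rewrite !inE => /andP[].
(* A common element is new or inherited on each side. New on both sides forces [i = j]; new for [i]
   only gives the edge; new for [j] only makes [j] precede [i]; inherited on both sides gives equal
   counts at [i < j], against strictness. *)
case/orP => /imfsetP[/= a a_i ->] /orP[] /imfsetP[/= b b_j];
  move=> /(pcan_inj choice.pickleK)[].
- by move=> eq_ij; rewrite eq_ij ltnn in lt_ij.
- by move=> -> _; rewrite (tnth_nth fset0).
- rewrite -tnth_nth in a_i; move: (allP (r_lt i) _ a_i) => lt_ai eq_aj.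
  by rewrite eq_aj ltnNge ltnW in lt_ai.
- move=> <-{b b_j} eq_count.
  have := count_take_lt (s := r) (a := fun T : {fset nat} => a \in T) lt_ij _ a_i.
  by rewrite size_tuple eq_count ltnn => /(_ (ltn_ord i)).
Qed.

Theorem theorem4p8 (R : realType) (t : nat) (t_gt0 : (0 < t)%N)
    (e0 e1 : error_measure R) :
  exactly_as_hard_as e0 e1 (SP R t) (BDIS R t).
Proof.
split.
- apply: (@online_reduction R e0 e1 (BDIS R t) (SP R t) (incident_set t)).
    exact: incident_set_online.
  move=> n r r_adm; have rs := meet_incident_set r_adm.
  have feas := eq_independent_pairwise_disjoint rs.
  split=> [|x|y] /=.
  + apply/forallP => i; rewrite -(eq_card_neighbours _ rs).
    by case/andP: r_adm => _ /forallP.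
  + by rewrite (eq_maximum_set _ feas).
  + by rewrite /accept_profit feas.
- apply: (@online_reduction R e0 e1 (SP R t) (BDIS R t) earlier_meeting).
    exact: earlier_meeting_online.
  move=> n r /forallP r_adm; have rs := adjacent_earlier_meeting r.
  have feas := eq_independent_pairwise_disjoint rs.
  split=> [|x|y] /=.
  + apply/andP; split; apply/forallP => i; first exact: translate_earlier_meeting_lt.
    by rewrite (eq_card_neighbours _ rs).
  + by rewrite (eq_maximum_set _ feas).
  + by rewrite /accept_profit feas.
Qed.
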